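(* Let $n,s,k\ge1$ be integers with $sk<n$, let $m>0$, $\mu>0$, $\varepsilon\in(0,1)$, and let $\mathcal{C}$ be the class of all unions of $k$ or of $k-1$ pairwise disjoint $s$-intervals in $\{1,\dots,n\}$. Suppose there are an adaptive sensing procedure satisfying the precision budget $\mathbb{E}_S\big(\sum_j\Gamma_j\big)\le m$ for every $S\in\mathcal{C}$ and an estimator $\hat S$ such that $\max_{S\in\mathcal{C}}\mathbb{E}_S(|\hat S\triangle S|)\le\varepsilon$. Then necessarily $$\mu \geq \sqrt{\frac{2(n-sk)}{sm} \left( \log k + \log\frac{n-sk}{n+s} + \log\frac{s}{8\varepsilon} \right)}$$ (the bound being void if the expression under the square root is negative).
   Context: An $s$-interval is a set $\{i,i+1,\dots,i+s-1\}$ with $1\le i\le n-s+1$; the union of $0$ intervals is the empty set. Sensing model. For an unknown support set $S\subseteq\{1,\dots,n\}$ and $\mu>0$, the signal $\boldsymbol{x}\in\mathbb{R}^n$ has $x_i=\mu$ if $i\in S$ and $x_i=0$ otherwise. One collects measurements $Y_j=x_{A_j}+\Gamma_j^{-1/2}W_j$, $j=1,2,\dots$, where $A_j\in\{1,\dots,n\}$ is the measured coordinate, $\Gamma_j>0$ is the precision, and the $W_j$ are i.i.d. $\mathcal{N}(0,1)$, with $W_j$ independent of $\{A_i,\Gamma_i\}_{i\le j}$ and of the past observations. An adaptive sensing procedure chooses $(A_j,\Gamma_j)$ as a (possibly randomized) function of $\{Y_i,A_i,\Gamma_i\}_{i<j}$, and may stop at a data-dependent time (sums over $j$ run over the measurements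 actually made). An estimator $\hat S\subseteq\{1,\dots,n\}$ is a function of all collected data. $\mathbb{P}_S,\mathbb{E}_S$ denote probability and expectation when the support is $S$. $\triangle$ is symmetric difference. *)

(* Defs.v *)
From mathcomp Require Import all_boot all_order all_algebra.
From mathcomp Require Import all_classical all_reals all_analysis.

Set Implicit Arguments.
Unset Strict Implicit.
Unset Printing Implicit Defensive.

Import Order.TTheory GRing.Theory Num.Theory.
Import numFieldNormedType.Exports.

Local Open Scope classical_set_scope.
Local Open Scope ring_scope.

(* Coordinates {1, ..., n} are encoded as 'I_n = {0, ..., n - 1}; the condition
   1 <= i <= n - s + 1 on the left end of an s-interval becomes i + s <= n. *)
Definition interval_set (n s i : nat) : {set 'I_n} :=
  [set j : 'I_n | (i <= j < i + s)%N]%SET.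

Definition is_interval (n s : nat) (I : {set 'I_n}) : Prop :=
  exists2 i : nat, (i + s <= n)%N & I = interval_set n s i.

Definition is_interval_union (n s q : nat) (S : {set 'I_n}) : Prop :=
  exists F : {set {set 'I_n}},
    [/\ #|F| = q, (forall I, I \in F -> is_interval s I), finset.trivIset F
      & finset.cover F = S].

Definition support_class (n s k : nat) (S : {set 'I_n}) : Prop :=
  is_interval_union s k S \/ is_interval_union s (k - 1) S.

Definition symdiff (n : nat) (A B : {set 'I_n}) : {set 'I_n} :=
  ((A :\: B) :|: (B :\: A))%SET.

Definition signal (R : realType) (n : nat) (mu : R) (S : {set 'I_n}) (i : 'I_n)
  : R := if i \in S then mu else 0.

(* One measurement is a triple (A_j, Gamma_j, Y_j). Data collected so far, or in
   total, is a sequence d with d j = None when there is no j-th measurement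
   (the first one has index 0). Total data may be infinite. *)
Definition cylinders (R : realType) (n : nat)
  : set (set (nat -> option ('I_n * R * R))) :=
  [set D | exists j (a : 'I_n) (G Y : set R),
     [/\ measurable G, measurable Y &
       D = [set d | exists g y, [/\ d j = Some (a, g, y), G g & Y y]]]].

Notation data R n := (g_sigma_algebraType (@cylinders R n)).

(* [decide u d] is the next (coordinate, precision) to use after having
   collected the data d, or None to stop; u is the value of an external random
   seed, which accounts for randomized choices. *)
Record sensing_procedure (R : realType) (n : nat) (dU : measure_display)
    (U : measurableType dU) := SensingProcedure {
  decide : U -> data R n -> option ('I_n * R) ;
  decide_precision_gt0 : forall u d a g, decide u d = Some (a, g) -> 0 < g ;
  decide_measurable : forall (a : 'I_n) (G : set R), measurable G ->
    measurable [set p : U * data R n |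
      exists2 g, decide p.1 p.2 = Some (a, g) & G g] }.

Record estimator (R : realType) (n : nat) := Estimator {
  estimate : data R n -> {set 'I_n} ;
  estimate_measurable : forall A : {set 'I_n},
    measurable [set d : data R n | estimate d = A] }.

Section Sensing.
Context (R : realType) (n : nat) (dU : measure_display) (U : measurableType dU).
Variables (proc : sensing_procedure R n U) (x : 'I_n -> R).
Variables (u : U) (w : nat -> R).

(* Data collected in the first j steps, for signal x, seed u and noise w. Once
   [decide] returns None the data no longer changes, so that the decision
   remains to stop. *)
Fixpoint history (j : nat) : data R n :=
  if j is j'.+1 then
    if decide proc u (history j') is Some (a, g) then
      fun i => if i == j' then Some (a, g, x a + (Num.sqrt g)^-1 * w j')
               else history j' i
    else history j'
  else fun _ => None.

Definition collected_data : data R n := fun j => history j.+1 j.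

Definition precision (j : nat) : R :=
  if decide proc u (history j) is Some (_, g) then g else 0.

Definition total_precision : \bar R :=
  (\sum_(0 <= j <oo) (precision j)%:E)%E.

End Sensing.

(* W_0, W_1, ... are i.i.d. N(0,1) and independent of the seed Z. The product
   rule covers all finite subfamilies since the B i may be taken to be setT. *)
Definition standard_noise (R : realType) (dO dU : measure_display)
    (Omega : measurableType dO) (U : measurableType dU)
    (P : probability Omega R) (Z : {RV P >-> U}) (W : nat -> {RV P >-> R})
  : Prop :=
  (forall j (B : set R), measurable B ->
     P (W j @^-1` B) = normal_prob 0 1 B) /\
  (forall (t : nat) (C : set U) (B : nat -> set R),
     measurable C -> (forall i, measurable (B i)) ->
     P (Z @^-1` C `&` \bigcap_(i < t) (W i @^-1` B i)) =
     (P (Z @^-1` C) * \prod_(i < t) P (W i @^-1` B i))%E).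

(* Main.v *)
(* Cut {1, ..., n} into N = floor(n / s) blocks of length s. Given a (k-1)-subset T
   of the blocks and a further block b, changing the support from T to T + b
   costs a Kullback-Leibler divergence mu^2 / 2 times the expected precision
   spent on b under T, so that for every coordinate i of b and every c >= 0
     c <= e^c (P_T(wrong at i) + P_(T+b)(wrong at i)) + KL(T, b).
   This is summed over all (T, b, i). Given T the divergences add up to at most
   mu^2 m / 2 over N - k + 1 >= (n - s k) / s blocks b; the error
   probabilities under T, and under T' = T + b, add up to at most eps.
   With c = mu^2 s m / (2 (n - s k)) + 1 this is the theorem, even with
   e instead of 8.

   The two-point inequality uses a common noise W: conditionally on the past,
   observing under x is the same as observing under x' with shifted noise, so
   events up to time t are reweighted by e^l, where l is the log-likelihood
   ratio (Girsanov). Then c <= e^c (1_B + 1_(~B) e^l) + (e^l - l - 1) pointwise and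
   E[e^l - l - 1] = KL. Events depending on the whole infinite data are
   approximated by events that depend on finitely many measurements. *)

Require Import Defs.
From mathcomp Require Import all_boot all_order all_algebra.
From mathcomp Require Import all_classical all_reals all_analysis.
From mathcomp Require Import measurable_realfun ring lra.
Import Order.TTheory GRing.Theory Num.Theory.
Import numFieldNormedType.Exports.
Local Open Scope classical_set_scope.
Local Open Scope ring_scope.

(** * The standard normal law *)

(* The library's normal law lives on [measurableTypeR R]; noise variables take
   values in [R] with its default measurable structure. *)
Section gauss_law_def.
Context {R : realType}.

Lemma measurable_id_measurableTypeR :
  @measurable_fun _ _ (measurableTypeR R) R setT idfun.
Proof. by move=> _ A mA; rewrite setTI. Qed.

Let gauss_law0 : probability R R :=
  @distribution _ _ (measurableTypeR R) R R (@normal_prob R 0 1)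
    (@mfun_Sub _ _ (measurableTypeR R) R idfun
      (mem_set measurable_id_measurableTypeR)).

(** Opaque on purpose: only the values on sets remain visible, so the pushforward along the identity
    never unfolds. *)
Fact gauss_law_subproof :
  {g : probability R R | forall B, g B = normal_prob 0 1 B}.
Proof. by exists gauss_law0. Qed.

Definition gauss_law : probability R R := sval gauss_law_subproof.

Lemma gauss_lawE (B : set R) : gauss_law B = normal_prob 0 1 B.
Proof. exact: (svalP gauss_law_subproof). Qed.

Lemma ge0_integral_gauss_law_normal_prob (f : R -> \bar R) :
  measurable_fun [set: R] f -> (forall x, 0 <= f x)%E ->
  (\int[gauss_law]_x f x = \int[@normal_prob R 0 1]_x f x)%E.
Proof.
move=> mf f0; transitivity (\int[gauss_law0]_x f x)%E.
  by apply: eq_measure_integral => A _ _; exact: gauss_lawE.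
exact: (@ge0_integral_pushforward _ _ (measurableTypeR R) R R idfun
   measurable_id_measurableTypeR (@normal_prob R 0 1) setT f).
Qed.

End gauss_law_def.

Section normal.
Context {R : realType}.
Local Notation leb := (@lebesgue_measure R).
Local Notation N := (@gauss_law R).

(** The image of Lebesgue measure under [phi] agrees with it on half-open intervals, hence
    everywhere by uniqueness. Used for translations and for the reflection. *)
Lemma lebesgue_integral_invariant (phi : R -> R) (f : R -> \bar R) :
  measurable_fun [set: R] phi ->
  (forall a b : R, leb (phi @^-1` `]a, b]) = leb `]a, b]) ->
  measurable_fun [set: R] f -> (forall x, 0 <= f x)%E ->
  (\int[leb]_x f (phi x) = \int[leb]_x f x)%E.
Proof.
move=> mphi phiE mf f0.
rewrite -[LHS](@ge0_integral_pushforward _ _ (measurableTypeR R)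
  (measurableTypeR R) R phi mphi leb setT f)//.
apply: eq_measure_integral => A mA _; apply/esym.
by apply: lebesgue_measure_unique => // X [[a b] _ <-]/=; rewrite -phiE.
Qed.

Lemma lebesgue_integral_shift (b : R) (f : R -> \bar R) :
  measurable_fun [set: R] f -> (forall x, 0 <= f x)%E ->
  (\int[leb]_x f (x + b)%R = \int[leb]_x f x)%E.
Proof.
apply: (lebesgue_integral_invariant (fun x => x + b)).
  by apply: measurable_funD.
move=> u v; rewrite (_ : _ @^-1` _ = `](u - b), (v - b)]%classic); last first.
  by apply/seteqP; split=> x /=; rewrite !in_itv/= ltrBlDr lerBrDr.
by rewrite !lebesgue_measure_itv/= !lte_fin ltrD2r -!EFinB opprB addrA subrK.
Qed.

Lemma lebesgue_integral_opp (f : R -> \bar R) :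
  measurable_fun [set: R] f -> (forall x, 0 <= f x)%E ->
  (\int[leb]_x f (- x)%R = \int[leb]_x f x)%E.
Proof.
apply: (lebesgue_integral_invariant -%R); first exact: oppr_measurable.
move=> u v; rewrite (_ : _ @^-1` _ = `[(- v), (- u)[%classic); last first.
  by apply/seteqP; split=> x /=; rewrite !in_itv/= andbC lerNl ltrNr.
rewrite !lebesgue_measure_itv/= !lte_fin ltrN2 -!EFinB opprK.
by rewrite (addrC (- u)).
Qed.

Lemma ge0_integral_gauss_law (f : R -> \bar R) :
  measurable_fun [set: R] f -> (forall x, 0 <= f x)%E ->
  (\int[N]_x f x = \int[leb]_x (f x * (normal_pdf 0 1 x)%:E))%E.
Proof.
move=> mf f0.
pose M := @normal_prob R 0 1; have dom : M `<< leb by exact: normal_prob_dominates.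
rewrite ge0_integral_gauss_law_normal_prob//.
rewrite -(Radon_Nikodym_SigmaFinite.change_of_variables dom f0 measurableT mf).
have mp : measurable_fun [set: R] (fun x : R => (normal_pdf 0 1 x)%:E).
  by apply/measurable_EFinP; exact: measurable_normal_pdf.
have irn := Radon_Nikodym_SigmaFinite.f_integrable dom.
have mrn := measurable_int _ irn.
apply: ge0_ae_eq_integral => //.
- exact: emeasurable_funM.
- exact: emeasurable_funM.
- by move=> x _; rewrite mule_ge0// Radon_Nikodym_SigmaFinite.f_ge0.
- by move=> x _; rewrite mule_ge0// lee_fin normal_pdf_ge0.
(* The Radon-Nikodym derivative and the Gaussian density have the same integral over every
   measurable set, hence agree almost everywhere. *)
have : ae_eq leb setT (Radon_Nikodym_SigmaFinite.f M leb)
    (fun x => (normal_pdf 0 1 x)%:E).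
  apply: integral_ae_eq => // E _ mE.
  by rewrite -Radon_Nikodym_SigmaFinite.f_integral.
by apply: filterS => x /= /(_ I) ->.
Qed.

Lemma normal_pdf01E (x : R) :
  normal_pdf 0 1 x = normal_peak 1 * expR (- (x ^+ 2 / 2)).
Proof.
rewrite normal_pdfE ?oner_eq0// /normal_fun subr0 expr1n mulNr.
by rewrite -mulr_natr mul1r.
Qed.

(** One-dimensional Girsanov formula: after a translation of Lebesgue measure, completing the square
    gives (w - b)^2 / 2 = w^2 / 2 - (b w - b^2 / 2). *)
Lemma gauss_law_shift (b : R) (f : R -> \bar R) :
  measurable_fun [set: R] f -> (forall x, 0 <= f x)%E ->
  (\int[N]_w f (w + b)%R =
   \int[N]_w (f w * (expR (b * w - b ^+ 2 / 2))%:E))%E.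
Proof.
move=> mf f0.
have me : measurable_fun [set: R] (fun w : R => (expR (b * w - b ^+ 2 / 2))%:E).
  apply/measurable_EFinP; apply: measurableT_comp => //.
  by apply: measurable_funB => //; exact: mulrl_measurable.
rewrite !ge0_integral_gauss_law//.
- pose g v := (f v * (normal_pdf 0 1 (v - b))%:E)%E.
  transitivity (\int[leb]_w g (w + b)%R)%E.
    by apply: eq_integral => w _; rewrite /g addrK.
  rewrite lebesgue_integral_shift.
  + apply: eq_integral => w _; rewrite /g -muleA -EFinM !normal_pdf01E.
    rewrite [in RHS]mulrCA -expRD.
    by do 4 congr (_ _); field.
  + apply: emeasurable_funM => //; apply/measurable_EFinP.
    apply: measurableT_comp; first exact: measurable_normal_pdf.
    exact: measurable_funB.
  + by move=> v; rewrite mule_ge0// lee_fin normal_pdf_ge0.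
- exact: emeasurable_funM.
- by move=> w; rewrite mule_ge0// lee_fin expR_ge0.
- by apply: measurableT_comp => //; exact: measurable_funD.
Qed.

Lemma gauss_law_opp (f : R -> \bar R) :
  measurable_fun [set: R] f -> (forall x, 0 <= f x)%E ->
  (\int[N]_w f (- w)%R = \int[N]_w f w)%E.
Proof.
move=> mf f0; rewrite !ge0_integral_gauss_law//; last first.
  by apply: measurableT_comp => //; exact: oppr_measurable.
rewrite -[RHS]lebesgue_integral_opp.
- by apply: eq_integral => w _; rewrite !normal_pdf01E sqrrN.
- apply: emeasurable_funM => //.
  by apply/measurable_EFinP; exact: measurable_normal_pdf.
- by move=> w; rewrite mule_ge0// lee_fin normal_pdf_ge0.
Qed.

Lemma gauss_law_expR (b : R) :
  (\int[N]_w (expR (b * w - b ^+ 2 / 2))%:E = 1)%E.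
Proof.
transitivity (\int[N]_w (cst 1 w * (expR (b * w - b ^+ 2 / 2))%:E))%E.
  by apply: eq_integral => w _; rewrite mul1e.
rewrite -gauss_law_shift//= integral_cst// mul1e.
exact: probability_setT.
Qed.

Lemma expRB_ge0 (l : R) : 0 <= expR l - l.
Proof. by rewrite subr_ge0 (le_trans _ (expR_ge1Dx l))// lerDr. Qed.

(* Symmetrising in w cancels the linear term, so that no first moment of the
   normal law is needed. *)
Lemma gauss_law_expRB (l b : R) :
  (\int[N]_w (expR (l + (b * w - b ^+ 2 / 2)) - (l + (b * w - b ^+ 2 / 2)))%:E
   = (expR l - l + b ^+ 2 / 2)%:E)%E.
Proof.
pose q w := expR (l + (b * w - b ^+ 2 / 2)) - (l + (b * w - b ^+ 2 / 2)).
have mlin (a : R) : measurable_fun [set: R] (fun w : R => a * w - b ^+ 2 / 2).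
  by apply: measurable_funB => //; exact: mulrl_measurable.
have mq : measurable_fun [set: R] q.
  apply: measurable_funB; last exact: measurable_funD.
  by apply: measurableT_comp => //; exact: measurable_funD.
pose e (a w : R) := expR (a * w - b ^+ 2 / 2).
have me a : measurable_fun [set: R] (e a) by exact: measurableT_comp.
have inte a : a ^+ 2 = b ^+ 2 -> N.-integrable setT (EFin \o e a).
  move=> ab; apply/integrableP; split; first exact/measurable_EFinP.
  under eq_integral do rewrite /= ger0_norm ?expR_ge0// /e -ab.
  by rewrite gauss_law_expR ltry.
(* One copy is reflected. In q(w) + q(-w) two exponentials of integral 1 and the constant b^2 - 2 l
   remain. *)
have qq : (\int[N]_w (q w)%:E + \int[N]_w (q w)%:E =
           (2 * (expR l - l + b ^+ 2 / 2))%:E)%E.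
  rewrite -[X in (X + _)%E]gauss_law_opp; last 2 first.
  - exact/measurable_EFinP.
  - by move=> w; rewrite lee_fin expRB_ge0.
  rewrite -ge0_integralD//; last 4 first.
  - by move=> w _; rewrite lee_fin expRB_ge0.
  - apply/measurable_EFinP; apply: measurableT_comp => //.
  - by move=> w _; rewrite lee_fin expRB_ge0.
  - exact/measurable_EFinP.
  transitivity (\int[N]_w ((expR l)%:E * (e b w)%:E +
      (expR l)%:E * (e (- b) w)%:E + (b ^+ 2 - 2 * l)%:E))%E.
    apply: eq_integral => w _; rewrite -!EFinM -!EFinD; congr EFin.
    by rewrite /q /e !mulrN !mulNr !expRD; field.
  have ie a : a ^+ 2 = b ^+ 2 ->
      N.-integrable setT (fun w => (expR l)%:E * (e a w)%:E)%E.
    by move=> ab; apply: integrableZl => //; exact: inte.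
  have iT : N.-integrable setT (fun _ : R => (b ^+ 2 - 2 * l)%:E).
    by apply: finite_measure_integrable_cst.
  have i1 := ie b erefl; have i2 := ie (- b) (sqrrN b).
  have /= -> := integralD measurableT (integrableD measurableT i1 i2) iT.
  have /= -> := integralD measurableT i1 i2.
  rewrite !integralZl//; [|exact: inte (sqrrN b)|exact: inte].
  have e1 a : a ^+ 2 = b ^+ 2 -> (\int[N]_w (e a w)%:E = 1)%E.
    by rewrite /e => <-; exact: gauss_law_expR.
  rewrite !e1 ?sqrrN// integral_cst//= probability_setT.
  by rewrite !mule1 -!EFinD; congr EFin; field.
(* The double of the integral is real, which rules out infinite values and permits halving. *)
have := qq; case: (\int[N]_w (q w)%:E)%E => [r| |]//.
move=> [h]; congr EFin; lra.
Qed.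

End normal.

(** * Adapted variables and independence of the next noise *)

Section independence.
Context {R : realType} {dO dU : measure_display} {Omega : measurableType dO}
  {U : measurableType dU} {P : probability Omega R} {Z : {RV P >-> U}}
  {W : nat -> {RV P >-> R}} (noise : standard_noise Z W).

(** Rectangles in the seed and the first t noises: a pi-system generating the information available
    to the measurement of index t. *)
Definition past (t : nat) : set (set Omega) :=
  [set E | exists C (B : nat -> set R), [/\ measurable C,
    forall i, measurable (B i) &
    E = Z @^-1` C `&` \bigcap_(i < t) (W i @^-1` B i)]].

Let mW t (B : set R) : measurable B -> measurable (W t @^-1` B).
Proof.
by move=> mB; rewrite -[X in measurable X]setTI; exact: measurable_funPT.
Qed.

Let mZ (C : set U) : measurable C -> measurable (Z @^-1` C).
Proof.
by move=> mC; rewrite -[X in measurable X]setTI; exact: measurable_funPT.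
Qed.

Lemma measurable_past t : past t `<=` measurable.
Proof.
move=> _ [C [B [mC mB ->]]]; apply: measurableI; first exact: mZ.
by apply: bigcap_measurableType => i _; exact: mW.
Qed.

Lemma setI_closed_past t : setI_closed (past t).
Proof.
move=> _ _ [C [B [mC mB ->]]] [C' [B' [mC' mB' ->]]].
exists (C `&` C'), (fun i => B i `&` B' i); split.
- exact: measurableI.
- by move=> i; exact: measurableI.
- rewrite preimage_setI setIACA; congr (_ `&` _).
  by rewrite -bigcapI; apply: eq_bigcapr => i _; rewrite preimage_setI.
Qed.

Lemma pastT t : past t setT.
Proof.
exists setT, (fun=> setT); split => //.
by rewrite preimage_setT setTI bigcapT.
Qed.

Lemma past_subset t : past t `<=` past t.+1.
Proof.
move=> _ [C [B [mC mB ->]]].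
exists C, (fun i => if (i < t)%N then B i else setT); split => //.
  by move=> i; case: ifP.
congr (_ `&` _); apply/seteqP; split => om h i /= it.
  by case: ifP => // it'; exact: h.
by have := h i (ltnW it); rewrite it.
Qed.

Lemma standard_noise_law t (B : set R) : measurable B ->
  P (W t @^-1` B) = gauss_law B.
Proof. by move=> mB; rewrite gauss_lawE; exact: noise.1. Qed.

(** For fixed [B] both sides are finite measures in [E]; they agree on the pi-system [past t] by the
    product rule, hence on the sigma-algebra it generates. *)
Lemma past_indep t E (B : set R) : <<s past t >> E -> measurable B ->
  P (E `&` W t @^-1` B) = (P E * gauss_law B)%E.
Proof.
move=> sE mB.
have gB : gauss_law B \is a fin_num by exact: fin_num_measure.
have gB0 : 0 <= fine (gauss_law B) by rewrite fine_ge0.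
pose m1 := mrestr P (mW t B mB).
pose m2 := mscale (NngNum gB0) P.
have m2E A : m2 A = (P A * gauss_law B)%E by rewrite [LHS]muleC -[in RHS](fineK gB).
suff : m1 E = m2 E by rewrite m2E.
apply: (g_sigma_algebra_measure_unique (past t) (measurable_past t) (fun=> setT)).
- by move=> _; exact: pastT.
- by rewrite bigcup_const//; exists 0%N.
- exact: setI_closed_past.
- move=> _ [C [D [mC mD ->]]]; apply: (etrans _ (esym (m2E _))).
  rewrite -[LHS]/(P _).
  have [_ ind] := noise.
  (* Puts [B] at index t, so that the product rule with t + 1 factors applies. *)
  pose D' i := if (i < t)%N then D i else B.
  have mD' i : measurable (D' i) by rewrite /D'; case: ifP.
  have D'E (i : 'I_t) : D' i = D i by rewrite /D' ltn_ord.
  have D't : D' t = B by rewrite /D' ltnn.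
  have := ind t.+1 C D' mC mD'.
  rewrite big_ord_recr/= D't muleA (standard_noise_law t B mB).
  under eq_bigr do rewrite D'E.
  rewrite -(ind t C D mC mD) => <-; congr (P _); rewrite -setIA; congr (_ `&` _).
  rewrite !bigcap_mkord big_ord_recr/= D't; congr (_ `&` _).
  by apply: eq_bigr => i _; rewrite D'E.
- move=> _; rewrite /m1 /mrestr (le_lt_trans (probability_le1 _ _))// ?ltry//.
  by rewrite setTI; exact: mW.
- by [].
Qed.

Lemma sigma_past_measurable t E : <<s past t >> E -> measurable E.
Proof.
apply: smallest_sub; last exact: measurable_past.
exact: sigma_algebra_measurable.
Qed.

Definition adapted {d} {T : measurableType d} t (X : Omega -> T) :=
  forall A, measurable A -> <<s past t >> (X @^-1` A).

Lemma adapted_measurable {d} {T : measurableType d} t (X : Omega -> T) :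
  adapted t X -> measurable_fun [set: Omega] X.
Proof.
by move=> aX _ A mA; rewrite setTI; apply: (sigma_past_measurable t); exact: aX.
Qed.

(** By independence the joint law of [X] and [W t] is a product, so Tonelli integrates the new noise
    out with the past frozen. *)
Lemma integral_freeze {d} {T : measurableType d} t (X : Omega -> T)
    (f : T * R -> \bar R) :
  adapted t X -> measurable_fun [set: T * R] f -> (forall q, 0 <= f q)%E ->
  (\int[P]_om f (X om, W t om) = \int[P]_om \int[gauss_law]_w f (X om, w))%E.
Proof.
move=> aX mf f0.
have mX := adapted_measurable _ _ aX.
have mXW : measurable_fun [set: Omega] (fun om => (X om, W t om)).
  by apply: measurable_fun_pair.
pose X' : {mfun Omega >-> T} := mfun_Sub (mem_set mX).
pose XW : {mfun Omega >-> (T * R)%type} := mfun_Sub (mem_set mXW).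
transitivity (\int[distribution P XW]_q f q)%E.
  by rewrite ge0_integral_pushforward.
transitivity (\int[distribution P X' \x gauss_law]_q f q)%E.
  apply: eq_measure_integral => A mA _; apply/esym.
  apply: product_measure_unique => // B C mB mC.
  by rewrite -(past_indep t)//; exact: aX.
rewrite fubini_tonelli1//.
rewrite ge0_integral_pushforward//; last first.
  by move=> x _; exact: integral_ge0.
exact: measurable_fun_fubini_tonelli_F.
Qed.

End independence.

(** * Change of measure for adaptive sensing *)

Section sensing_step.
Context {R : realType} {n : nat} {dU : measure_display} {U : measurableType dU}
  (proc : sensing_procedure R n U).

(** As precisions are positive, the value 0 marks that [a] is not measured next, be it because of
    another coordinate or of stopping. *)
Definition prec_at (a : 'I_n) (p : U * data R n) : R :=
  if decide proc p.1 p.2 is Some (a', g) then if a' == a then g else 0 else 0.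

Lemma prec_at_ge0 a p : 0 <= prec_at a p.
Proof.
rewrite /prec_at; case E : decide => [[a' g]|//]; case: ifP => // _.
exact/ltW/(decide_precision_gt0 E).
Qed.

Lemma prec_at_preimage a (B : set R) : ~ B 0 ->
  prec_at a @^-1` B =
  [set p | exists2 g, decide proc p.1 p.2 = Some (a, g) & B g].
Proof.
move=> B0; apply/seteqP; split => p /=; rewrite /prec_at.
  case: decide => [[a' g]|] //; case: eqP => [->|_] //.
  by exists g.
by move=> [g -> ?]; rewrite eqxx.
Qed.

Lemma measurable_prec_at a : measurable_fun [set: U * data R n] (prec_at a).
Proof.
have H (B : set R) : measurable B -> ~ B 0 -> measurable (prec_at a @^-1` B).
  by move=> mB B0; rewrite prec_at_preimage//; exact: decide_measurable.
move=> _ B mB; rewrite setTI.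
have [B0|B0] := pselect (B 0); last exact: H.
(* If [B] contains the default value 0, its complement does not, and the first case applies to
   that. *)
rewrite -[X in measurable X]setCK; apply: measurableC.
rewrite -[X in measurable X]/(prec_at a @^-1` (~` B)).
by apply: H; [exact: measurableC|move=> /(_ B0)].
Qed.

Lemma sum_prec_at (F : 'I_n -> R -> R) p : (forall a, F a 0 = 0) ->
  \sum_a F a (prec_at a p) =
  if decide proc p.1 p.2 is Some (a, g) then F a g else 0.
Proof.
move=> F0; rewrite /prec_at; case: decide => [[a g]|]; last first.
  by rewrite big1.
rewrite (bigD1 a)//= eqxx big1 ?addr0// => b ba.
by rewrite eq_sym (negPf ba).
Qed.

(** Since [F a 0 = 0], the case distinction on the decision is a finite sum of functions of the real
    variables [prec_at a]. *)
Lemma measurable_decide (F : 'I_n -> R -> R) :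
  (forall a, F a 0 = 0) -> (forall a, measurable_fun [set: R] (F a)) ->
  measurable_fun [set: U * data R n] (fun p =>
    if decide proc p.1 p.2 is Some (a, g) then F a g else 0).
Proof.
move=> F0 mF.
apply: (@eq_measurable_fun _ _ _ _ setT (fun p => \sum_a F a (prec_at a p))).
  by move=> p _; exact: sum_prec_at.
apply: measurable_sum => a; apply: measurableT_comp; first exact: mF.
exact: measurable_prec_at.
Qed.

(** The recursion step of [history] as a function of seed, past data and one noise value, the form
    in which the noise can be integrated out. *)
Definition step (x : 'I_n -> R) (t : nat) (q : (U * data R n) * R) : data R n :=
  if decide proc q.1.1 q.1.2 is Some (a, g) then
    fun i => if i == t then Some (a, g, x a + (Num.sqrt g)^-1 * q.2)
             else q.1.2 i
  else q.1.2.

Lemma history_step x u w t : history proc x u w t.+1 =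
  step x t ((u, history proc x u w t), w t).
Proof. by []. Qed.

Lemma measurable_cylinder j (a : 'I_n) (G Y : set R) :
  measurable G -> measurable Y ->
  measurable [set d : data R n | exists g y, [/\ d j = Some (a, g, y), G g & Y y]].
Proof.
by move=> mG mY; apply: sub_sigma_algebra; exists j, a, G, Y.
Qed.

Lemma measurable_fun_data d (T : measurableType d) (X : T -> data R n) :
  (forall j (a : 'I_n) (G Y : set R), measurable G -> measurable Y ->
    measurable [set q | exists g y, [/\ X q j = Some (a, g, y), G g & Y y]]) ->
  measurable_fun [set: T] X.
Proof.
move=> H; apply: (@measurability _ _ T (data R n) setT X (@cylinders R n)) => //.
by move=> _ [_ [j [a [G [Y [mG mY ->]]]]] <-]; rewrite setTI; exact: H.
Qed.

Lemma measurable_step x t :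
  measurable_fun [set: (U * data R n) * R] (step x t).
Proof.
apply: measurable_fun_data => j a G Y mG mY.
pose p_ a := @prec_at a \o @fst (U * data R n) R.
have mp a' : measurable_fun [set: (U * data R n) * R] (p_ a').
  by apply: measurableT_comp => //; exact: measurable_prec_at.
have mdec (B : set R) : measurable B -> measurable [set q : (U * data R n) * R |
    exists2 g, decide proc q.1.1 q.1.2 = Some (a, g) & B g].
  move=> mB.
  rewrite [X in measurable X](_ : _ = fst @^-1` [set p : U * data R n |
    exists2 g, decide proc p.1 p.2 = Some (a, g) & B g])//.
  rewrite -[X in measurable X]setTI; apply: measurable_fst => //.
  exact: decide_measurable.
have mold : measurable [set q : (U * data R n) * R |
    exists g y, [/\ q.1.2 j = Some (a, g, y), G g & Y y]].
  rewrite [X in measurable X](_ : _ = (snd \o fst) @^-1` [set d : data R n |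
    exists g y, [/\ d j = Some (a, g, y), G g & Y y]])//.
  rewrite -[X in measurable X]setTI.
  have m2 : measurable_fun [set: (U * data R n) * R] (snd \o fst).
    exact: measurableT_comp.
  by apply: m2 => //; exact: measurable_cylinder.
have [jt|jt] := eqVneq j t; last first.
  rewrite [X in measurable X](_ : _ = [set q : (U * data R n) * R |
    exists g y, [/\ q.1.2 j = Some (a, g, y), G g & Y y]])//.
  apply/seteqP; split => q /=; rewrite /step; case: decide => [[a' g']|]//;
    by rewrite (negPf jt).
pose new q := x a + (Num.sqrt (p_ a q))^-1 * q.2.
have mnew : measurable_fun [set: (U * data R n) * R] new.
  apply: measurable_funD => //; apply: measurable_funM => //.
  rewrite (_ : (fun q => _) = (fun q => (p_ a q) `^ (- 2^-1))); last first.
    by apply/funext => q; rewrite powRN powR12_sqrt// prec_at_ge0.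
  exact: (measurableT_comp (measurable_powR (- 2^-1)) (mp a)).
(* Vanishes exactly when the procedure stops, which makes stopping a measurable event. *)
pose len (q : (U * data R n) * R) :=
  if decide proc q.1.1 q.1.2 is Some (_, g) then g else 0.
have mlen : measurable_fun [set: (U * data R n) * R] len.
  exact: (measurableT_comp (measurable_decide (fun _ g => g) _ _)).
pose stop := len @^-1` [set 0].
have stopE q : stop q <-> decide proc q.1.1 q.1.2 = None.
  rewrite /stop /len/=; case E: decide => [[a' g]|]//; split => // g0.
  by have := decide_precision_gt0 E; rewrite g0 ltxx.
have mstop : measurable stop.
  by rewrite -[X in measurable X]setTI; exact: mlen.
(* Entry t is the new measurement if one is made; otherwise it is the old entry, which for arbitrary
   data need not be empty. *)
rewrite [X in measurable X](_ : _ = ([set q : (U * data R n) * R |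
    exists2 g, decide proc q.1.1 q.1.2 = Some (a, g) & G g] `&` new @^-1` Y) `|`
  (stop `&` [set q : (U * data R n) * R |
    exists g y, [/\ q.1.2 j = Some (a, g, y), G g & Y y]])).
  apply: measurableU; apply: measurableI => //; first exact: mdec.
  by rewrite -[X in measurable X]setTI; exact: mnew.
apply/seteqP; split => q /=.
  rewrite stopE /step /new /p_/= /prec_at.
  case: decide => [[a' g']|]; last by right.
  rewrite jt eqxx => -[g [y [[-> -> <-] Gg Yy]]]; left; rewrite eqxx; split => //.
  by exists g.
case=> [[[g]]|[]].
  rewrite /new /p_ /step /= /prec_at => -> Gg; rewrite !eqxx jt => Yn.
  by exists g, (x a + (Num.sqrt g)^-1 * q.2); rewrite eqxx.
by rewrite stopE /step => ->.
Qed.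

End sensing_step.

Section drift.
Context {R : realType} {n : nat} {dU : measure_display} {U : measurableType dU}
  (proc : sensing_procedure R n U) (x x' : 'I_n -> R).

(* Adding drift to the noise under x' gives the measurement obtained under x. *)
Definition drift (p : U * data R n) : R :=
  if decide proc p.1 p.2 is Some (a, g) then (x a - x' a) * Num.sqrt g else 0.

Lemma measurable_drift : measurable_fun [set: U * data R n] drift.
Proof.
apply: (@eq_measurable_fun _ _ _ _ setT (fun p : U * data R n =>
    if decide proc p.1 p.2 is Some (a, g) then (x a - x' a) * g `^ 2^-1 else 0)).
  move=> p _ /=; rewrite /drift; case E : decide => [[a g]|//].
  by rewrite powR12_sqrt// ltW// (decide_precision_gt0 E).
apply: (measurable_decide proc (fun a g => (x a - x' a) * g `^ 2^-1)).
  by move=> a; rewrite powR0 ?mulr0// invr_neq0.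
by move=> a; apply: measurable_funM => //; exact: measurable_powR.
Qed.

Lemma step_drift t p w :
  step proc x t (p, w) = step proc x' t (p, w + drift p).
Proof.
rewrite /step /drift/=; case E : decide => [[a g]|//].
apply/funext => i; case: ifP => // _; congr (Some (_, _)).
have g0 : 0 < Num.sqrt g by rewrite sqrtr_gt0 (decide_precision_gt0 E).
by field; rewrite gt_eqF.
Qed.

End drift.

Section adapted_theory.
Context {R : realType} {dO dU : measure_display} {Omega : measurableType dO}
  {U : measurableType dU} {P : probability Omega R} {Z : {RV P >-> U}}
  {W : nat -> {RV P >-> R}}.
Local Notation past := (@past R dO dU Omega U P Z W).
Local Notation adapted := (@adapted R dO dU Omega U P Z W _ _).

(** Adaptedness thereby inherits the closure properties of measurability. *)
Lemma adaptedP {d} {T : measurableType d} t (X : Omega -> T) :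
  adapted t X <->
  measurable_fun [set: g_sigma_algebraType (past t)] X.
Proof.
split=> [aX _ A mA|mX A mA]; first by rewrite setTI; exact: aX.
by have := mX measurableT A mA; rewrite setTI.
Qed.

Lemma adapted_comp {d d'} {T : measurableType d} {T' : measurableType d'} t
    (X : Omega -> T) (f : T -> T') :
  adapted t X -> measurable_fun [set: T] f -> adapted t (f \o X).
Proof. by move=> /adaptedP aX mf; apply/adaptedP; exact: measurableT_comp. Qed.

Lemma adapted_pair {d d'} {T : measurableType d} {T' : measurableType d'} t
    (X : Omega -> T) (Y : Omega -> T') :
  adapted t X -> adapted t Y -> adapted t (fun om => (X om, Y om)).
Proof.
by move=> /adaptedP aX /adaptedP aY; apply/adaptedP; exact: measurable_fun_pair.
Qed.

Lemma adapted_cst {d} {T : measurableType d} t (c : T) : adapted t (fun=> c).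
Proof. by apply/adaptedP; exact: measurable_cst. Qed.

Lemma adaptedS {d} {T : measurableType d} t (X : Omega -> T) :
  adapted t X -> adapted t.+1 X.
Proof.
move=> aX A mA; have := aX A mA.
apply: sub_smallest2r; last exact: past_subset.
exact: smallest_sigma_algebra.
Qed.

Lemma adapted_seed t : adapted t Z.
Proof.
move=> A mA; apply: sub_sigma_algebra; exists A, (fun=> setT); split => //.
by apply/seteqP; split => [om|om []].
Qed.

Lemma adapted_noise t : adapted t.+1 (W t).
Proof.
move=> A mA; apply: sub_sigma_algebra.
exists setT, (fun i => if i == t then A else setT); split => //.
  by move=> i; case: ifP.
rewrite preimage_setT setTI; apply/seteqP; split => om h.
  by move=> i _ /=; case: eqP => [->|].
by have := h t (ltnSn t); rewrite /= eqxx.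
Qed.

End adapted_theory.

(** * Likelihood ratio of two signals *)

Section likelihood.
Context {R : realType} {n : nat} {dO dU : measure_display}
  {Omega : measurableType dO} {U : measurableType dU} {P : probability Omega R}
  {Z : {RV P >-> U}} {W : nat -> {RV P >-> R}} (noise : standard_noise Z W)
  (proc : sensing_procedure R n U).
Local Notation adapted := (@adapted R dO dU Omega U P Z W _ _).

Definition state (x : 'I_n -> R) t (om : Omega) : U * data R n :=
  (Z om, history proc x (Z om) (W ^~ om) t).

Lemma adapted_state x t : adapted t (state x t).
Proof.
elim: t => [|t IH].
  exact: (adapted_pair 0 Z (fun=> _) (adapted_seed 0) (adapted_cst 0 _)).
apply: (adapted_pair t.+1 Z (fun om => step proc x t (state x t om, W t om))).
  exact: adapted_seed.
apply: (adapted_comp t.+1 (fun om => (state x t om, W t om)) (step proc x t)).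
  by apply: adapted_pair; [exact: adaptedS|exact: adapted_noise].
exact: measurable_step.
Qed.

Lemma measurable_state x t : measurable_fun [set: Omega] (state x t).
Proof. exact: adapted_measurable (adapted_state x t). Qed.

Section girsanov.
Variables x x' : 'I_n -> R.
Local Notation drift := (drift proc x x').

(** Log-likelihood ratio of [x] against [x'] after t steps, along the run under [x']. A step after
    stopping has drift 0 and adds nothing. *)
Fixpoint loglik t (om : Omega) : R :=
  if t is t'.+1 then
    let b := drift (state x' t' om) in
    loglik t' om + (b * W t' om - b ^+ 2 / 2)
  else 0.

Let loglik_step (q : (U * data R n) * R * R) : R :=
  q.1.2 + (drift q.1.1 * q.2 - drift q.1.1 ^+ 2 / 2).

Let measurable_loglik_step :
  measurable_fun [set: (U * data R n) * R * R] loglik_step.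
Proof.
have mb : measurable_fun [set: (U * data R n) * R * R]
    (drift \o (fst \o fst)).
  apply: measurableT_comp; first exact: measurable_drift.
  exact: measurableT_comp.
apply: measurable_funD; first exact: measurableT_comp.
apply: measurable_funB; first exact: measurable_funM.
by apply: measurable_funM => //; exact: measurable_funX.
Qed.

Lemma adapted_loglik t :
  adapted t (fun om => (state x' t om, loglik t om)).
Proof.
elim: t => [|t IH].
  by apply: adapted_pair; [exact: adapted_state|exact: adapted_cst].
apply: adapted_pair; first exact: adapted_state.
apply: (adapted_comp t.+1 (fun om => (state x' t om, loglik t om, W t om))
  loglik_step).
  by apply: adapted_pair; [exact: adaptedS|exact: adapted_noise].
exact: measurable_loglik_step.
Qed.

Lemma measurable_loglik t : measurable_fun [set: Omega] (loglik t).
Proof.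
by have /measurable_fun_pairP[] := adapted_measurable _ _ (adapted_loglik t).
Qed.

(** Induction on t for all [f] at once: with the past frozen, the last noise is shifted by the
    drift, which contributes one more factor of the likelihood ratio. *)
Lemma girsanov t (f : U * data R n -> \bar R) :
  measurable_fun [set: U * data R n] f -> (forall p, 0 <= f p)%E ->
  (\int[P]_om f (state x t om) =
   \int[P]_om (f (state x' t om) * (expR (loglik t om))%:E))%E.
Proof.
elim: t f => [|t IH] f mf f0.
  by apply: eq_integral => om _; rewrite /= expR0 mule1.
pose F y (q : (U * data R n) * R) := f (q.1.1, step proc y t q).
have mF y : measurable_fun [set: (U * data R n) * R] (F y).
  apply: measurableT_comp => //; apply: measurable_fun_pair.
    exact: measurableT_comp.
  exact: measurable_step.
have F0 y q : (0 <= F y q)%E by exact: f0.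
have mF2 y p : measurable_fun [set: R] (fun w => F y (p, w)).
  exact: measurable_fun_pair2.
have me (c b : R) : measurable_fun [set: R]
    (fun w => (expR (c + (b * w - b ^+ 2 / 2)))%:E).
  apply/measurable_EFinP/measurableT_comp => //; apply: measurable_funD => //.
  by apply: measurable_funB => //; exact: mulrl_measurable.
(* The conditional expectation of [f] given the state at time t, to which the induction hypothesis
   is applied. *)
pose G p := (\int[gauss_law]_w F x (p, w))%E.
have mG : measurable_fun [set: U * data R n] G.
  exact: measurable_fun_fubini_tonelli_F.
transitivity (\int[P]_om G (state x t om))%E.
  exact: (integral_freeze noise t (state x t) (F x) (adapted_state x t)
    (mF x) (F0 x)).
rewrite IH//; last by move=> p; exact: integral_ge0.
pose K (q : (U * data R n) * R * R) :=
  (F x' (q.1.1, q.2) * (expR (loglik_step q))%:E)%E.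
have mK : measurable_fun [set: (U * data R n) * R * R] K.
  apply: emeasurable_funM.
    apply: measurableT_comp => //; apply: measurable_fun_pair => //.
    exact: measurableT_comp.
  by apply/measurable_EFinP/measurableT_comp => //; exact: measurable_loglik_step.
have K0 q : (0 <= K q)%E by rewrite mule_ge0// lee_fin expR_ge0.
rewrite [RHS](integral_freeze noise t (fun om => (state x' t om, loglik t om)) K
  (adapted_loglik t) mK K0).
apply: eq_integral => om _; rewrite /K /loglik_step/=.
set p := state x' t om; set l := loglik t om.
rewrite [X in (X * _)%E](_ : _ = \int[gauss_law]_w
    (F x' (p, w) * (expR (drift p * w - drift p ^+ 2 / 2))%:E))%E; last first.
  rewrite -gauss_law_shift//; apply: eq_integral => w _.
  by rewrite /F (step_drift proc x x').
rewrite -ge0_integralZr//; last 2 first.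
- apply: emeasurable_funM => //.
  by have := me 0 (drift p); under eq_fun do rewrite add0r.
- by move=> w _; rewrite mule_ge0// lee_fin expR_ge0.
by apply: eq_integral => w _; rewrite -muleA -EFinM -expRD addrC.
Qed.

(* Minus the log-likelihood ratio is not known to be integrable beforehand,
   while expR (loglik) - loglik is nonnegative. *)
Lemma integral_expR_loglikB t :
  (\int[P]_om (expR (loglik t om) - loglik t om)%:E =
   1 + \int[P]_om (\sum_(j < t) (drift (state x' j om)) ^+ 2 / 2)%:E)%E.
Proof.
have mb j : measurable_fun [set: Omega] (fun om => drift (state x' j om)).
  by apply: measurableT_comp; [exact: measurable_drift|exact: measurable_state].
have mb2 j : measurable_fun [set: Omega]
    (fun om => (drift (state x' j om)) ^+ 2 / 2).
  by apply: measurable_funM => //; exact: measurable_funX.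
have ms s : measurable_fun [set: Omega]
    (fun om => \sum_(j < s) (drift (state x' j om)) ^+ 2 / 2).
  exact: measurable_sum.
have s0 s om : 0 <= \sum_(j < s) (drift (state x' j om)) ^+ 2 / 2.
  by apply: sumr_ge0 => j _; rewrite divr_ge0// sqr_ge0.
elim: t => [|t IH].
  under [in RHS]eq_integral do rewrite big_ord0.
  rewrite integral0 adde0; under eq_integral do rewrite /= expR0 subr0.
  by rewrite integral_cst//= probability_setT mule1.
pose K (q : (U * data R n) * R * R) :=
  (expR (loglik_step q) - loglik_step q)%:E.
have mK : measurable_fun [set: (U * data R n) * R * R] K.
  have mL := measurable_loglik_step.
  by apply/measurable_EFinP/measurable_funB => //; exact: measurableT_comp.
have K0 q : (0 <= K q)%E by rewrite lee_fin expRB_ge0.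
rewrite [LHS](integral_freeze noise t (fun om => (state x' t om, loglik t om)) K
  (adapted_loglik t) mK K0).
(* Given the past, one measurement raises the expectation of e^l - l by half the squared drift. *)
have KE om : (\int[gauss_law]_w K (state x' t om, loglik t om, w) =
    (expR (loglik t om) - loglik t om)%:E +
    (drift (state x' t om) ^+ 2 / 2)%:E)%E.
  by rewrite -EFinD -gauss_law_expRB.
transitivity (\int[P]_om ((expR (loglik t om) - loglik t om)%:E +
    (drift (state x' t om) ^+ 2 / 2)%:E))%E.
  by apply: eq_integral => om _; exact: KE.
have ml := measurable_loglik t.
rewrite ge0_integralD//=; last 4 first.
- by move=> om _; rewrite lee_fin expRB_ge0.
- by apply/measurable_EFinP/measurable_funB => //; exact: measurableT_comp.
- by move=> om _; rewrite lee_fin divr_ge0// sqr_ge0.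
- by apply/measurable_EFinP; exact: mb2.
rewrite IH -addeA; congr (_ + _)%E.
rewrite -ge0_integralD//=; last 4 first.
- by move=> om _; rewrite lee_fin; exact: s0.
- by apply/measurable_EFinP; exact: ms.
- by move=> om _; rewrite lee_fin divr_ge0// sqr_ge0.
- by apply/measurable_EFinP; exact: mb2.
by apply: eq_integral => om _; rewrite big_ord_recr.
Qed.

End girsanov.

End likelihood.
Arguments state {R n dO dU Omega U P} Z W proc x t om.
Arguments measurable_state {R n dO dU Omega U P} Z W proc x t.
Arguments loglik {R n dO dU Omega U P} Z W proc x x' t om.
Arguments measurable_loglik {R n dO dU Omega U P} Z W proc x x' t.

(** * Testing from infinite data *)

Lemma measure_subU2 d (T : measurableType d) (R : realType)
    (mu : {measure set T -> \bar R}) (X A B : set T) :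
  measurable X -> measurable A -> measurable B -> X `<=` A `|` B ->
  (mu X <= mu A + mu B)%E.
Proof.
move=> mX mA mB XAB; apply: le_trans (measureU2 mu mA mB).
by apply: le_measure; rewrite ?inE//; exact: measurableU.
Qed.

(** * Approximation of events by finitely many measurements *)

Section truncation.
Context {R : realType} {n : nat}.

Definition trunc t (d : data R n) : data R n :=
  fun i => if (i < t)%N then d i else None.

Lemma truncK t t' d : (t <= t')%N -> trunc t (trunc t' d) = trunc t d.
Proof.
move=> tt'; apply/funext => i; rewrite /trunc; case: ifP => // it.
by rewrite (leq_trans it tt').
Qed.

Lemma measurable_trunc t : measurable_fun [set: data R n] (trunc t).
Proof.
apply: measurable_fun_data => j a G Y mG mY.
have [jt|tj] := ltnP j t.
  rewrite [X in measurable X](_ : _ = [set d : data R n |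
    exists g y, [/\ d j = Some (a, g, y), G g & Y y]]).
    exact: measurable_cylinder.
  by apply/seteqP; split => d /=; rewrite /trunc jt.
rewrite [X in measurable X](_ : _ = set0)//.
by apply/seteqP; split => d //=; rewrite /trunc ltnNge tj => -[g [y []]].
Qed.

Definition finite_time : set (set (data R n)) :=
  [set E | exists t B, measurable B /\ E = trunc t @^-1` B].

Lemma finite_timeP E1 E2 : finite_time E1 -> finite_time E2 ->
  exists t B1 B2, [/\ measurable B1, measurable B2,
    E1 = trunc t @^-1` B1 & E2 = trunc t @^-1` B2].
Proof.
move=> [t1 [B1 [mB1 ->]]] [t2 [B2 [mB2 ->]]].
exists (maxn t1 t2), (trunc t1 @^-1` B1), (trunc t2 @^-1` B2); split.
- by rewrite -[X in measurable X]setTI; exact: measurable_trunc.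
- by rewrite -[X in measurable X]setTI; exact: measurable_trunc.
- by apply/seteqP; split => d /=; rewrite truncK// leq_maxl.
- by apply/seteqP; split => d /=; rewrite truncK// leq_maxr.
Qed.

Lemma finite_time_measurable E : finite_time E -> measurable E.
Proof.
move=> [t [B [mB ->]]].
by rewrite -[X in measurable X]setTI; exact: measurable_trunc.
Qed.

Lemma cylinders_finite_time : @cylinders R n `<=` finite_time.
Proof.
move=> _ [j [a [G [Y [mG mY ->]]]]].
exists j.+1, [set d : data R n | exists g y, [/\ d j = Some (a, g, y), G g & Y y]].
split; first exact: measurable_cylinder.
by apply/seteqP; split => d /=; rewrite /trunc ltnSn.
Qed.

(** The approximable events form a lambda-system. It contains the finite-time events, a pi-system
    including all cylinders, hence every measurable event. *)
Lemma finite_time_approx (mu : {measure set (data R n) -> \bar R})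
    (A : set (data R n)) (e : R) :
  (mu setT < +oo)%E -> measurable A -> 0 < e ->
  exists2 E, finite_time E & (mu (A `\` E) + mu (E `\` A) <= e%:E)%E.
Proof.
move=> muT mA; move: e.
pose S : set (set (data R n)) := [set A | measurable A /\ forall e : R, 0 < e ->
  exists2 E, finite_time E & (mu (A `\` E) + mu (E `\` A) <= e%:E)%E].
suff : S A by case.
have mE := finite_time_measurable.
have ftS : finite_time `<=` S.
  move=> E ftE; split; first exact: mE.
  by move=> e e0; exists E => //; rewrite !setDv !measure0 adde0 lee_fin ltW.
have lS : lambda_system setT S.
  split => //.
  - by apply: ftS; exists 0%N, setT.
  - move=> A1 A2 _ [mA1 h1] [mA2 h2]; split; first exact: measurableD.
    move=> e e0; have e2 : 0 < e / 2 by rewrite divr_gt0.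
    have [E1 ftE1 le1] := h1 _ e2; have [E2 ftE2 le2] := h2 _ e2.
    have [mE1 mE2] := (mE _ ftE1, mE _ ftE2).
    exists (E1 `\` E2).
      have [t [B1 [B2 [mB1 mB2 -> ->]]]] := finite_timeP _ _ ftE1 ftE2.
      by exists t, (B1 `\` B2); split => //; exact: measurableD.
    rewrite (splitr e) EFinD; apply: le_trans (leeD le1 le2).
    rewrite [X in (_ <= _ + X)%E]addeC [leRHS]addeACA; apply: leeD.
      apply: measure_subU2; do ?exact: measurableD.
        by apply: measurableD; exact: measurableD.
      move=> d [[A1d nA2d] /not_andP[nE1|/contrapT E2d]]; first by left.
      by right.
    apply: measure_subU2; do ?exact: measurableD.
      by apply: measurableD; exact: measurableD.
    move=> d [[E1d nE2d] /not_andP[nA1|/contrapT A2d]]; first by left.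
    by right.
  - move=> F ndF SF; have mF i : measurable (F i) by have [] := SF i.
    have mUF : measurable (\bigcup_i F i) by exact: bigcupT_measurable.
    split => // e e0; have e2 : 0 < e / 2 by rewrite divr_gt0.
    (* The missing parts decrease to the empty set; as [mu] is finite, some [F N] misses at most e /
       2, and approximating [F N] costs the other half. *)
    pose G i := (\bigcup_i F i) `\` F i.
    have : (mu \o G) i @[i --> \oo] --> mu (\bigcap_i G i).
      apply: nonincreasing_cvg_mu.
      + apply: le_lt_trans muT; apply: le_measure; rewrite ?inE//.
        exact: measurableD.
      + by move=> i; exact: measurableD.
      + by apply: bigcapT_measurable => i; exact: measurableD.
      + by move=> i j ij; apply/subsetPset; apply: setDS; apply/subsetPset/ndF.
    have -> : \bigcap_i G i = set0.
      apply/seteqP; split => // d h; have [[i _ Fi] _] := h 0%N I.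
      by have [_] := h i I.
    rewrite measure0 => /fine_cvgP[[N1 _ finG]] /cvgrPdist_lt/(_ _ e2)[N2 _ ltG].
    pose N := maxn N1 N2.
    have muG : (mu (G N) <= (e / 2)%:E)%E.
      have fG : mu (G N) \is a fin_num by apply: finG; exact: leq_maxl.
      rewrite -(fineK fG) lee_fin ltW//.
      have := ltG N (leq_maxr _ _); rewrite /= sub0r normrN.
      exact: le_lt_trans (ler_norm _).
    have [E ftE leE] := (SF N).2 _ e2; have mEE := mE _ ftE.
    exists E => //; rewrite (splitr e) EFinD.
    apply: le_trans (leeD muG leE); rewrite addeA; apply: leeD.
      apply: measure_subU2; do ?exact: measurableD.
      move=> d [UFd nEd]; have [FNd|nFNd] := pselect (F N d); first by right.
      by left.
    apply: le_measure; rewrite ?inE; do ?exact: measurableD.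
    by apply: setDS; exact: bigcup_sup.
have GE : <<s @cylinders R n >> `<=` <<s finite_time >>.
  apply: sub_smallest2r; last exact: cylinders_finite_time.
  exact: smallest_sigma_algebra.
apply: (@lambda_system_subset _ finite_time _ setT S lS ftS) => //; last exact: GE.
move=> E1 E2 ftE1 ftE2.
have [t [B1 [B2 [mB1 mB2 -> ->]]]] := finite_timeP _ _ ftE1 ftE2.
by exists t, (B1 `&` B2); split => //; exact: measurableI.
Qed.

End truncation.

Section testing.
Context {R : realType} {n : nat} {dO dU : measure_display}
  {Omega : measurableType dO} {U : measurableType dU} {P : probability Omega R}
  {Z : {RV P >-> U}} {W : nat -> {RV P >-> R}} (noise : standard_noise Z W)
  (proc : sensing_procedure R n U).

Definition collected (x : 'I_n -> R) (om : Omega) : data R n :=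
  collected_data proc x (Z om) (W ^~ om).

Lemma history_ge x u w t j : (t <= j)%N -> history proc x u w t j = None.
Proof.
elim: t => [//|t IH] tj; rewrite history_step /step /=.
case: decide => [[a g]|]; last by rewrite IH// ltnW.
by rewrite gtn_eqF// IH// ltnW.
Qed.

(** Entry j is written at step j and never changed, so finite-time events of the total data are
    events of the history. *)
Lemma history_trunc x om t :
  history proc x (Z om) (W ^~ om) t = trunc t (collected x om).
Proof.
apply/funext => j; rewrite /trunc; case: ltnP => jt; last exact: history_ge.
rewrite /collected /collected_data.
elim: t jt => [//|t IH]; rewrite ltnS leq_eqVlt => /predU1P[->//|jt].
rewrite history_step /step/=.
case: decide => [[a g]|]; last exact: IH.
by rewrite ltn_eqF// IH.
Qed.

Lemma measurable_history x t : measurable_fun [set: Omega]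
  (fun om => history proc x (Z om) (W ^~ om) t : data R n).
Proof.
have := measurable_state Z W proc x t.
by move=> /measurable_fun_pairP[].
Qed.

Lemma measurable_collected x : measurable_fun [set: Omega] (collected x).
Proof.
apply: measurable_fun_data => j a G Y mG mY.
rewrite -[X in measurable X]/((fun om =>
  history proc x (Z om) (W ^~ om) j.+1 : data R n) @^-1`
  [set d : data R n | exists g y, [/\ d j = Some (a, g, y), G g & Y y]]).
rewrite -[X in measurable X]setTI; apply: measurable_history => //.
exact: measurable_cylinder.
Qed.

Variables (x x' : 'I_n -> R).
Local Notation drift t om := (drift proc x x' (state Z W proc x' t om)).
Local Notation loglik := (loglik Z W proc x x').
Local Notation hist y t om := (history proc y (Z om) (W ^~ om) t).

(** Girsanov moves the probability under [x] to the run under [x']; then a pointwise inequality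
    between nonnegative functions is integrated. *)
Lemma finite_test (c : R) t (B : set (data R n)) : 0 <= c -> measurable B ->
  (c%:E <= (expR c)%:E * (P [set om | B (hist x' t om)] +
                          P [set om | ~ B (hist x t om)]) +
           \int[P]_om (\sum_(j < t) (drift j om) ^+ 2 / 2)%:E)%E.
Proof.
move=> c0 mB.
have mS y (D : set (data R n)) : measurable D ->
    measurable [set om | D (hist y t om)].
  move=> mD; rewrite -[X in measurable X]setTI.
  exact: (measurable_history y t measurableT D mD).
have PE (S : set Omega) : measurable S -> P S = (\int[P]_om (\1_S om)%:E)%E.
  by move=> mS'; rewrite integral_indic// setIT.
have mCB : measurable (~` B) by exact: measurableC.
have ml := measurable_loglik Z W proc x x' t.
have mel : measurable_fun [set: Omega] (fun om => expR (loglik t om)).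
  exact: measurableT_comp.
have -> : P [set om | ~ B (hist x t om)] =
    (\int[P]_om (\1_(~` B) (hist x' t om) * expR (loglik t om))%:E)%E.
  rewrite PE; last exact: mS x (~` B) mCB.
  pose f (p : U * data R n) := (\1_(~` B) p.2 : R)%:E.
  transitivity (\int[P]_om f (state Z W proc x t om))%E.
    by apply: eq_integral => om _; rewrite /f !indicE.
  rewrite (girsanov noise proc x x' t f)//.
  - by apply/measurable_EFinP/measurableT_comp => //; exact: measurable_indic.
  - by move=> p; rewrite lee_fin.
rewrite PE; last exact: mS.
have mi D : measurable D ->
    measurable_fun [set: Omega] (fun om => \1_D (hist x' t om) : R).
  move=> mD; apply: measurableT_comp; first exact: measurable_indic.
  exact: measurable_history.
pose I1 := (\int[P]_om (\1_B (hist x' t om))%:E)%E.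
pose I2 := (\int[P]_om (\1_(~` B) (hist x' t om) * expR (loglik t om))%:E)%E.
pose I3 := (\int[P]_om (\sum_(j < t) (drift j om) ^+ 2 / 2)%:E)%E.
change (c%:E <= (expR c)%:E * (I1 + I2) + I3)%E.
have I12 : (I1 + I2 = \int[P]_om (\1_B (hist x' t om) +
    \1_(~` B) (hist x' t om) * expR (loglik t om))%:E)%E.
  rewrite -ge0_integralD//.
  - by apply/measurable_EFinP; exact: mi.
  - by apply/measurable_EFinP/measurable_funM => //; exact: mi.
(* The extra 1 on both sides matches the expectation 1 + [I3] of e^l - l; it is cancelled at the
   end. *)
have key : ((1 + c)%:E <= (expR c)%:E * (I1 + I2) + (1 + I3))%E.
  rewrite -integral_expR_loglikB// I12 -ge0_integralZl//; last first.
  - apply/measurable_EFinP/measurable_funD; first exact: mi.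
    by apply: measurable_funM => //; exact: mi.
  have m1 : measurable_fun [set: Omega] (fun om => (expR c)%:E *
      (\1_B (hist x' t om) + \1_(~` B) (hist x' t om) * expR (loglik t om))%:E)%E.
    apply/measurable_EFinP/measurable_funM => //; apply: measurable_funD => //.
      exact: mi.
    by apply: measurable_funM => //; exact: mi.
  have m2 : measurable_fun [set: Omega]
      (fun om => (expR (loglik t om) - loglik t om)%:E).
    by apply/measurable_EFinP/measurable_funB.
  rewrite -ge0_integralD//; last first.
    by move=> om _; rewrite lee_fin expRB_ge0.
  rewrite -[leLHS]mule1 -[X in (_ * X)%E](probability_setT P) -integral_cst//.
  apply: ge0_le_integral => //.
  - by move=> om _; rewrite lee_fin addr_ge0.
  - exact: emeasurable_funD.
  move=> om _; rewrite -!EFinD lee_fin.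
  set l := loglik t om.
  have lB := expRB_ge0 l; have ec := expR_ge1Dx c.
  (* On [B], use e^c >= 1 + c and e^l >= l. Off [B], use e^(c + l) >= 1 + c + l, whose l cancels the
     -l. *)
  rewrite !indicE in_setC; case: (_ \in B) => /=.
    by rewrite mul0r addr0 mulr1; lra.
  rewrite add0r mul1r -expRD; have := expR_ge1Dx (c + l); have := expR_ge0 l; lra.
have : (1%:E + c%:E <= 1%:E + ((expR c)%:E * (I1 + I2) + I3))%E.
  by rewrite addeCA.
by rewrite leeD2lE.
Qed.

Lemma test_bound (c : R) (A : set (data R n)) : 0 <= c -> measurable A ->
  (c%:E <= (expR c)%:E * (P [set om | A (collected x' om)] +
                          P [set om | ~ A (collected x om)]) +
           \int[P]_om (\sum_(0 <= j <oo) ((drift j om) ^+ 2 / 2)%:E))%E.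
Proof.
move=> c0 mA; apply/lee_addgt0Pr => e e0.
have mc y := measurable_collected y.
have mcP y (D : set (data R n)) : measurable D ->
    measurable (collected y @^-1` D).
  by move=> mD; rewrite -[X in measurable X]setTI; exact: mc.
pose X y : {mfun Omega >-> data R n} := mfun_Sub (mem_set (mc y)).
(* Approximating for the sum of both laws gives one event that is good under each. *)
pose nu := measure_add (distribution P (X x')) (distribution P (X x)).
have nuE D : nu D = (P (collected x' @^-1` D) + P (collected x @^-1` D))%E.
  exact: measure_addE.
have nuT : (nu setT < +oo)%E.
  by rewrite nuE !preimage_setT probability_setT ltry.
(* Each of the two probabilities moves by at most e' and is multiplied by e^c, so the total loss is
   e. *)
pose e' := e / (2 * expR c).
have e'0 : 0 < e' by rewrite divr_gt0// mulr_gt0// expR_gt0.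
have [E0 [t [B [mB ->]]] leE] := finite_time_approx nu A e' nuT mA e'0.
set E := trunc t @^-1` B in leE.
have mE : measurable E by apply: finite_time_measurable; exists t, B.
have nu_le D : measurable D -> (nu D <= e'%:E)%E ->
    (P (collected x' @^-1` D) <= e'%:E)%E /\ (P (collected x @^-1` D) <= e'%:E)%E.
  by rewrite nuE => mD h; split; apply: le_trans h; rewrite ?leeDl ?leeDr.
have [l1 _] : (P (collected x' @^-1` (E `\` A)) <= e'%:E)%E /\
              (P (collected x @^-1` (E `\` A)) <= e'%:E)%E.
  by apply: nu_le; [exact: measurableD|apply: le_trans leE; rewrite leeDr].
have [_ l2] : (P (collected x' @^-1` (A `\` E)) <= e'%:E)%E /\
              (P (collected x @^-1` (A `\` E)) <= e'%:E)%E.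
  by apply: nu_le; [exact: measurableD|apply: le_trans leE; rewrite leeDl].
have p1 : (P [set om | B (hist x' t om)] <=
    P [set om | A (collected x' om)] + e'%:E)%E.
  apply: le_trans (leeD (lexx _) l1); apply: measure_subU2.
  - have := mcP x' _ mE.
    by rewrite /E/preimage/=; under eq_set do rewrite -history_trunc.
  - exact: mcP.
  - by apply: mcP; exact: measurableD.
  - move=> om /=; rewrite history_trunc => Bom.
    by have [Aom|nAom] := pselect (A (collected x' om)); [left|right].
have p2 : (P [set om | ~ B (hist x t om)] <=
    P [set om | ~ A (collected x om)] + e'%:E)%E.
  apply: le_trans (leeD (lexx _) l2); apply: measure_subU2.
  - have := mcP x _ (measurableC mE).
    by rewrite /E/preimage/=; under eq_set do rewrite -history_trunc.
  - by apply: (mcP x (~` A)); exact: measurableC.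
  - by apply: mcP; exact: measurableD.
  - move=> om /=; rewrite history_trunc => Bom.
    by have [Aom|nAom] := pselect (A (collected x om)); [right|left].
apply: le_trans (finite_test c t B c0 mB) _.
rewrite addeAC; apply: leeD.
  apply: (@le_trans _ _ ((expR c)%:E * ((P [set om | A (collected x' om)] + e'%:E) +
      (P [set om | ~ A (collected x om)] + e'%:E)))%E).
    by apply: lee_wpmul2l; rewrite ?lee_fin ?expR_ge0//; exact: leeD.
  have e'0' : (0%:E <= e'%:E)%E by rewrite lee_fin ltW.
  rewrite addeACA ge0_muleDr ?adde_ge0//.
  apply: leeD => //; rewrite -EFinD -EFinM lee_fin /e'.
  have := expR_gt0 c; set ec := expR c => ec0.
  by rewrite le_eqVlt; apply/orP; left; apply/eqP; field; rewrite gt_eqF.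
have mb j : measurable_fun [set: Omega] (fun om => drift j om).
  apply: measurableT_comp; [exact: measurable_drift|exact: measurable_state].
have mb2 j : measurable_fun [set: Omega] (fun om => (drift j om) ^+ 2 / 2).
  by apply: measurable_funM => //; exact: measurable_funX.
have b2 j om : 0 <= (drift j om) ^+ 2 / 2 by rewrite divr_ge0// sqr_ge0.
apply: ge0_le_integral => //.
- by move=> om _; rewrite lee_fin sumr_ge0.
- by apply/measurable_EFinP; exact: measurable_sum.
- apply: ge0_emeasurable_sum => [j om _ _|j _]; first by rewrite lee_fin.
  by apply/measurable_EFinP; exact: mb2.
move=> om _; rewrite -sumEFin.
rewrite -(big_mkord xpredT (fun j => ((drift j om) ^+ 2 / 2)%:E)).
by apply: nneseries_lim_ge => j _ _; rewrite lee_fin.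
Qed.

End testing.
Arguments collected {R n dO dU Omega U P} Z W proc x om.
Arguments measurable_collected {R n dO dU Omega U P} Z W proc x.

(** * Averaging over unions of blocks *)

Section blocks.
Variables (n s : nat).
Hypothesis s_gt0 : (0 < s)%N.
Local Notation N := (n %/ s)%N.

Definition block (b : 'I_N) : {set 'I_n} := interval_set n s (b * s).

Definition blocks (T : {set 'I_N}) : {set 'I_n} := (\bigcup_(b in T) block b)%SET.

(** The quotient of a coordinate by s names its block, whence the disjointness of blocks. *)
Lemma in_block (b : 'I_N) (i : 'I_n) : (i \in block b) = (i %/ s == b)%N.
Proof.
rewrite inE eqn_leq leq_divRL// andbC; congr andb.
by rewrite -[RHS]ltnS ltn_divLR// mulSn addnC.
Qed.

Lemma blocksU1 (b : 'I_N) (T : {set 'I_N}) :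
  blocks (b |: T)%SET = (block b :|: blocks T)%SET.
Proof.
apply/finset.setP => i; rewrite finset.in_setU; apply/finset.bigcupP/orP.
  move=> [b' /finset.setU1P[->|b'T] ib']; [by left|right].
  by apply/finset.bigcupP; exists b'.
case=> [ib|/finset.bigcupP[b' b'T ib']]; first by exists b; rewrite ?finset.setU11.
by exists b' => //; rewrite finset.setU1r.
Qed.

Lemma notin_blocks (b : 'I_N) (T : {set 'I_N}) (i : 'I_n) :
  b \notin T -> i \in block b -> i \notin blocks T.
Proof.
move=> bT; rewrite in_block => /eqP ib; apply/finset.bigcupP => -[b' b'T].
rewrite in_block ib => /eqP bb'.
by rewrite (val_inj bb') b'T in bT.
Qed.

Lemma block_fit (b : 'I_N) : (b * s + s <= n)%N.
Proof. by rewrite addnC -mulSn -leq_divRL. Qed.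

Lemma card_block (b : 'I_N) : #|block b| = s.
Proof.
rewrite -sum1_card; under eq_bigl do rewrite inE.
rewrite -(big_mkord (fun j => b * s <= j < b * s + s)%N (fun=> 1%N)).
transitivity (\sum_(b * s <= j < b * s + s) 1)%N; last first.
  by rewrite sum_nat_const_nat muln1 addKn.
by rewrite [RHS](big_nat_widenl _ 0)// [RHS](big_nat_widen _ _ n) ?block_fit//.
Qed.

Lemma block_inj : injective block.
Proof.
move=> b b' bb'; apply/val_inj/eqP.
have ltn : (b * s < n)%N.
  by apply: leq_trans (block_fit b); rewrite -addn1 leq_add2l.
have := in_block b' (Ordinal ltn).
by rewrite -bb' in_block /= mulnK// eqxx => /esym.
Qed.

Lemma blocks_interval_union (T : {set 'I_N}) :
  is_interval_union s #|T| (blocks T).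
Proof.
exists [set block b | b in T]%SET; split.
- by rewrite card_imset//; exact: block_inj.
- move=> I /imsetP[b _ ->]; exists (b * s)%N => //; exact: block_fit.
- apply/finset.trivIsetP => A B /imsetP[b _ ->] /imsetP[b' _ ->] bb'.
  rewrite -finset.setI_eq0; apply/eqP/finset.setP => i.
  rewrite inE !in_block finset.in_set0.
  apply/negP => /andP[/eqP e /eqP e']; move/eqP: bb'; apply; congr block.
  by apply: val_inj; rewrite /= -e -e'.
- by rewrite cover_imset.
Qed.

Lemma sum_in_block (R : numDomainType) (A : {pred 'I_N}) (i : 'I_n) (r : R) :
  0 <= r -> \sum_(b in A | i \in block b) r <= r.
Proof.
move=> r0; rewrite sumr_const -mulr_natr ler_piMr// -[leRHS]/(1%:R) ler_nat.
apply/card_le1_eqP => b b' /andP[_ +] /andP[_]; rewrite !in_block.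
by move=> /eqP e /eqP e'; apply: val_inj; rewrite /= -e -e'.
Qed.

(** After exchanging the sums, each coordinate is counted at most once. *)
Lemma sum_blocks (R : numDomainType) (A : {pred 'I_N}) (F : 'I_n -> R) :
  (forall i, 0 <= F i) ->
  \sum_(b in A) \sum_(i in block b) F i <= \sum_i F i.
Proof.
move=> F0; rewrite (exchange_big_dep xpredT)//=; apply: ler_sum => i _.
exact: sum_in_block.
Qed.

(** Double counting: a (q+1)-set with a marked element is the same as a q-set with an element
    outside it. *)
Lemma sum_add_block (V : nmodType) (q : nat) (F : {set 'I_N} -> 'I_N -> V) :
  \sum_(T : {set 'I_N} | #|T| == q.+1) \sum_(b in T) F T b =
  \sum_(T : {set 'I_N} | #|T| == q) \sum_(b in (~: T)%SET) F (b |: T)%SET b.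
Proof.
rewrite !pair_big_dep/=.
rewrite (reindex_onto (fun p : {set 'I_N} * 'I_N => (p.2 |: p.1, p.2)%SET)
  (fun p => (p.1 :\ p.2, p.2)%SET)) /=; last first.
  by move=> [T b]/= /andP[_ bT]; rewrite finset.setD1K.
apply: eq_bigl => -[T b] /=; rewrite xpair_eqE eqxx andbT finset.setU11 andbT.
rewrite finset.in_setC cardsU1; case: (boolP (b \in T)) => /= bT; last first.
  by rewrite add1n eqSS andbT finset.setU1K// eqxx andbT.
rewrite andbF; apply/negP => /andP[_ /eqP h].
by move: bT; rewrite -h !inE eqxx.
Qed.

End blocks.

(** * Coordinatewise errors and divergences *)

Section errors.
Context {R : realType} {n : nat} {dO dU : measure_display}
  {Omega : measurableType dO} {U : measurableType dU} {P : probability Omega R}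
  {Z : {RV P >-> U}} {W : nat -> {RV P >-> R}} (noise : standard_noise Z W)
  (proc : sensing_procedure R n U) (Shat : estimator R n) (mu : R).

Definition wrong (S : {set 'I_n}) (i : 'I_n) : set Omega :=
  [set om | (i \in estimate Shat (collected Z W proc (signal mu S) om)) != (i \in S)].

Definition error (S : {set 'I_n}) (i : 'I_n) : R := fine (P (wrong S i)).

Lemma measurable_detected (i : 'I_n) :
  measurable [set d : data R n | i \in estimate Shat d].
Proof.
rewrite [X in measurable X](_ : _ =
    \big[setU/set0]_(A : {set 'I_n} | i \in A)
      [set d : data R n | estimate Shat d = A]).
  by apply: bigsetU_measurable => A _; exact: estimate_measurable.
rewrite -bigcup_seq_cond; apply/seteqP; split => d /=.
  by move=> id; exists (estimate Shat d) => //=; rewrite mem_index_enum.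
by move=> [A /= /andP[_ iA] ->].
Qed.

Lemma measurable_wrong S i : measurable (wrong S i).
Proof.
have mc := measurable_collected Z W proc (signal mu S).
have mD := measurable_detected i.
rewrite /wrong; case: (i \in S).
  rewrite [X in measurable X](_ : _ = 
    collected Z W proc (signal mu S) @^-1` ~` [set d : data R n | i \in estimate Shat d]).
    by rewrite -[X in measurable X]setTI; apply: mc => //; exact: measurableC.
  by apply/seteqP; split => om /=; rewrite eqb_id => /negP.
rewrite [X in measurable X](_ : _ = 
    collected Z W proc (signal mu S) @^-1` [set d : data R n | i \in estimate Shat d]).
  by rewrite -[X in measurable X]setTI; apply: mc.
by apply/seteqP; split => om /=; rewrite eqbF_neg negbK.
Qed.

Lemma errorE S i : (error S i)%:E = P (wrong S i).
Proof. by rewrite /error fineK// fin_num_measure//; exact: measurable_wrong. Qed.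

Lemma error_ge0 S i : 0 <= error S i.
Proof. by rewrite fine_ge0. Qed.

Lemma sum_errorE S :
  ('E_P[fun om => #|symdiff
    (estimate Shat (collected_data proc (signal mu S) (Z om) (W ^~ om))) S|%:R]
   = (\sum_i error S i)%:E)%E.
Proof.
rewrite unlock -sumEFin.
transitivity (\int[P]_om (\sum_i (\1_(wrong S i) om)%:E))%E.
  apply: eq_integral => om _; rewrite sumEFin; congr EFin.
  rewrite -sum1_card natr_sum big_mkcond/=; apply: eq_bigr => i _.
  rewrite indicE (_ : (om \in wrong S i) = ((i \in estimate Shat
      (collected_data proc (signal mu S) (Z om) (W ^~ om))) != (i \in S))).
    by rewrite /symdiff !finset.inE; case: (i \in estimate _ _); case: (i \in S).
  by apply/idP/idP; rewrite inE.
rewrite ge0_integral_sum//; last first.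
  by move=> i; apply/measurable_EFinP/measurable_indic; exact: measurable_wrong.
apply: eq_bigr => i _; rewrite errorE integral_indic ?setIT//.
exact: measurable_wrong.
Qed.

(** Divergence of the data law under [S'] from that under [S], given directly by the Gaussian
    formula: half the expected sum of squared drifts along the run under [S']. *)
Definition kl (S S' : {set 'I_n}) : \bar R :=
  (\int[P]_om \sum_(0 <= j <oo)
    ((drift proc (signal mu S) (signal mu S')
        (state Z W proc (signal mu S') j om)) ^+ 2 / 2)%:E)%E.

Lemma kl_ge0 S S' : (0 <= kl S S')%E.
Proof.
apply: integral_ge0 => om _; apply: nneseries_ge0 => j _ _.
by rewrite lee_fin divr_ge0// sqr_ge0.
Qed.

(** The tested event is that i is detected: a false alarm under [S'], while its complement is a miss
    under [S]. *)
Lemma error_bound (S S' : {set 'I_n}) (i : 'I_n) (c : R) : 0 <= c ->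
  i \in S -> i \notin S' ->
  (c%:E <= (expR c * (error S i + error S' i))%:E + kl S S')%E.
Proof.
move=> c0 iS iS'.
have := test_bound noise proc (signal mu S) (signal mu S') c _ c0
  (measurable_detected i).
rewrite -/(kl S S') EFinM EFinD !errorE (addeC (P (wrong S i))).
rewrite (_ : [set om | _] = wrong S' i); last first.
  by apply/seteqP; split => om; rewrite /wrong/= (negPf iS') eqbF_neg negbK.
rewrite (_ : [set om | ~ _] = wrong S i)//.
by apply/seteqP; split => om; rewrite /wrong/= iS eqb_id => /negP.
Qed.

(** All divergences are taken along the same run, under [T], so they share one precision budget. *)
Lemma sum_kl s (T : {set 'I_(n %/ s)}) : (0 < s)%N ->
  (\sum_(b in (~: T)%SET) kl (blocks n s (b |: T)%SET) (blocks n s T) <=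
   (mu ^+ 2 / 2)%:E * \int[P]_om
     total_precision proc (signal mu (blocks n s T)) (Z om) (W ^~ om))%E.
Proof.
move=> s0; set x' := signal mu (blocks n s T).
pose st := state Z W proc x'.
pose x b := signal mu (blocks n s (b |: T)%SET).
pose f b j om := (drift proc (x b) x' (st j om)) ^+ 2 / 2.
have mst j : measurable_fun [set: Omega] (st j) by exact: measurable_state.
have mf b j : measurable_fun [set: Omega] (f b j).
  apply: measurable_funM => //; apply: measurable_funX.
  by apply: measurableT_comp; [exact: measurable_drift|exact: mst].
have f0 b j om : 0 <= f b j om by rewrite divr_ge0// sqr_ge0.
pose pr j om := precision proc x' (Z om) (W ^~ om) j.
have mpr j : measurable_fun [set: Omega] (pr j).
  exact: (measurableT_comp (measurable_decide proc (fun _ g => g) _ _) (mst j)).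
have pr0 j om : 0 <= pr j om.
  rewrite /pr /precision; case E : decide => [[a g]|//].
  exact/ltW/(decide_precision_gt0 E).
have mS b : measurable_fun [set: Omega]
    (fun om => \sum_(0 <= j <oo) (f b j om)%:E)%E.
  apply: ge0_emeasurable_sum => [j om _ _|j _]; first by rewrite lee_fin.
  by apply/measurable_EFinP; exact: mf.
(* A measurement at a informs only about the block containing a, and at most one block does. *)
have key j om : \sum_(b in (~: T)%SET) f b j om <= mu ^+ 2 / 2 * pr j om.
  rewrite /f /drift /pr /precision /st/=.
  case E : decide => [[a g]|]; last first.
    by rewrite mulr0 big1// => b _; rewrite expr0n mul0r.
  have g0 : 0 <= g by exact/ltW/(decide_precision_gt0 E).
  have xE b : b \in (~: T)%SET ->
      ((x b a - x' a) * Num.sqrt g) ^+ 2 / 2 =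
      if a \in block n s b then mu ^+ 2 / 2 * g else 0.
    rewrite finset.in_setC => bT; rewrite exprMn sqr_sqrtr// /x /x' /signal.
    rewrite blocksU1 finset.in_setU; have [ab|ab] := boolP (a \in block n s b).
      by rewrite (negPf (notin_blocks _ _ s0 _ _ _ bT ab))/= subr0 mulrAC.
    by rewrite subrr expr0n !mul0r.
  rewrite (eq_bigr _ xE) -big_mkcondr; apply: sum_in_block => //.
  by rewrite mulr_ge0// divr_ge0// sqr_ge0.
have mtot : measurable_fun [set: Omega]
    (fun om => total_precision proc x' (Z om) (W ^~ om)).
  apply: ge0_emeasurable_sum => [j om _ _|j _]; first by rewrite lee_fin; exact: pr0.
  by apply/measurable_EFinP; exact: mpr.
have tot0 om : (0 <= total_precision proc x' (Z om) (W ^~ om))%E.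
  by apply: nneseries_ge0 => j _ _; rewrite lee_fin; exact: pr0.
have c0 : 0 <= mu ^+ 2 / 2 by rewrite divr_ge0// sqr_ge0.
rewrite -ge0_integralZl//.
rewrite -big_filter -ge0_integral_sum//; last first.
  by move=> b om _; apply: nneseries_ge0 => j _ _; rewrite lee_fin; exact: f0.
apply: ge0_le_integral => //.
- move=> om _; apply: sume_ge0 => b _.
  by apply: nneseries_ge0 => j _ _; rewrite lee_fin; exact: f0.
- by apply: emeasurable_sum => b; exact: mS.
- exact: measurable_funeM.
move=> om _; rewrite -nneseries_sum; last by move=> b j _; rewrite lee_fin; exact: f0.
rewrite /total_precision -nneseriesZl; last by move=> j _; rewrite lee_fin; exact: pr0.
apply: lee_nneseries => [j _ _|j _].
  by apply: sume_ge0 => b _; rewrite lee_fin; exact: f0.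
by rewrite big_filter sumEFin -EFinM lee_fin; exact: key.
Qed.

End errors.
Arguments error {R n dO dU Omega U P} Z W proc Shat mu S i.
Arguments kl {R n dO dU Omega U P} Z W proc mu S S'.
Arguments sum_kl {R n dO dU Omega U P} Z W proc mu s T.

(** * Solving for the signal strength *)

Lemma expR1_le8 (R : realType) : expR 1 <= 8 :> R.
Proof.
have h : expR (- (1 / 2)) >= 1 / 2 :> R.
  by apply: le_trans (expR_ge1Dx _); lra.
have e0 : 0 < expR (1 / 2) :> R by exact: expR_gt0.
have e2 : expR (1 / 2) <= 2 :> R.
  rewrite expRN -(ler_pM2l e0) mulfV ?gt_eqF// in h; lra.
have -> : 1 = 1 / 2 + 1 / 2 :> R by lra.
by rewrite expRD; nra.
Qed.

(** Take logarithms of the second bound and use mu^2 = 2 D K / (s m); the factor 8 absorbs the e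
    coming from K + 1. *)
Lemma ln_bound_sqrt (R : realType) (D k n s m mu eps K : R) :
  0 < D -> 0 < k -> 0 < n -> 0 < s -> 0 < m -> 0 < mu -> 0 < eps ->
  K = mu ^+ 2 / 2 * (s * m / D) ->
  s <= expR (K + 1) * eps * (n / (k * D)) ->
  Num.sqrt (2 * D / (s * m) * (ln k + ln (D / n) + ln (s / (8 * eps)))) <= mu.
Proof.
move=> D0 k0 n0 s0 m0 mu0 eps0 KE h.
have Dn0 : 0 < D / n by rewrite divr_gt0.
have se0 : 0 < s / (8 * eps) by rewrite divr_gt0// mulr_gt0.
rewrite -[leRHS]ger0_norm ?(ltW mu0)// -sqrtr_sqr ler_sqrt ?sqr_ge0//.
have -> : mu ^+ 2 = 2 * D / (s * m) * K.
  by rewrite KE; field; rewrite !gt_eqF.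
apply: ler_wpM2l; first by rewrite ltW// divr_gt0// mulr_gt0.
have kDn0 : 0 < k * (D / n) by exact: mulr_gt0.
rewrite -!lnM ?posrE// -[leRHS]expRK ler_ln ?posrE ?expR_gt0//; last first.
  exact: mulr_gt0.
have -> : k * (D / n) * (s / (8 * eps)) = s / (eps * (n / (k * D))) / 8.
  by field; rewrite !gt_eqF.
rewrite ler_pdivrMr// ler_pdivrMr; last by rewrite !mulr_gt0// invr_gt0 mulr_gt0.
apply: (le_trans h); rewrite -mulrA; apply: ler_wpM2r.
  by rewrite ltW// !mulr_gt0// invr_gt0 mulr_gt0.
rewrite expRD; apply: ler_wpM2l; [exact: expR_ge0|exact: expR1_le8].
Qed.

(** Here [C1] and [C2] stand for the numbers of (k-1)-sets and k-sets of blocks, [A] for the number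
    of blocks outside a (k-1)-set, and [v] for mu^2 m / 2. *)
Lemma averaged_bound (R : realType) (C1 C2 A D k s c K E eps n v : R) :
  0 < C1 -> 0 < A -> 0 < D -> 0 < k -> 0 < s -> 0 <= v -> 0 <= E -> 0 <= eps ->
  k * C2 = A * C1 -> D <= s * A -> D + s * k <= n -> K = v * (s / D) ->
  c = K + 1 ->
  C1 * (A * (s * c)) <= E * (C2 * eps + C1 * eps) + C1 * (s * v) ->
  s <= E * eps * (n / (k * D)).
Proof.
move=> C10 A0 D0 k0 s0 v0 E0 eps0 kC2 DsA Dn KE cE h.
have A1 : A^-1 <= s / D.
  by rewrite -[A^-1]mul1r ler_pdivrMr// mulrAC ler_pdivlMr// mul1r.
have C2E : C2 = A * C1 / k by rewrite -kC2; field; rewrite gt_eqF.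
(* Division by [C1] times [A], with [C2] / ([C1] [A]) = 1 / k. The last term is at most s K, so c =
   K + 1 leaves s on the left. *)
have h1 : s * c <= E * eps * (k^-1 + A^-1) + s * v * A^-1.
  rewrite -(ler_pM2l (mulr_gt0 C10 A0)).
  have -> : C1 * A * (s * c) = C1 * (A * (s * c)) by ring.
  apply: (le_trans h); rewrite C2E le_eqVlt; apply/orP; left; apply/eqP.
  by field; rewrite !gt_eqF.
have h2 : s * v * A^-1 <= s * K.
  rewrite KE -mulrA ler_wpM2l//; first exact: ltW.
  exact: ler_wpM2l.
have h3 : E * eps * (k^-1 + A^-1) <= E * eps * (n / (k * D)).
  apply: ler_wpM2l; first exact: mulr_ge0.
  apply: (@le_trans _ _ (k^-1 + s / D)); first by rewrite lerD2l.
  have -> : k^-1 + s / D = (D + s * k) / (k * D) by field; rewrite !gt_eqF.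
  by apply: ler_wpM2r => //; rewrite invr_ge0 mulr_ge0 ?ltW.
by rewrite cE mulrDr mulr1 in h1; lra.
Qed.

Lemma blocks_support_class (n s k : nat) (T : {set 'I_(n %/ s)}) : (0 < s)%N ->
  #|T| = k \/ #|T| = (k - 1)%N -> support_class s k (blocks n s T).
Proof.
by move=> s0 [cT|cT]; [left|right]; rewrite -cT; exact: blocks_interval_union.
Qed.

Theorem proposition15 (R : realType) (n s k : nat) (m mu eps : R)
    (n_ge1 : (1 <= n)%N) (s_ge1 : (1 <= s)%N) (k_ge1 : (1 <= k)%N)
    (sk_lt_n : (s * k < n)%N)
    (m_gt0 : 0 < m) (mu_gt0 : 0 < mu) (eps_gt0 : 0 < eps) (eps_lt1 : eps < 1)
    (dO dU : measure_display)
    (Omega : measurableType dO) (P : probability Omega R)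
    (U : measurableType dU) (Z : {RV P >-> U}) (W : nat -> {RV P >-> R})
    (noise : standard_noise Z W)
    (proc : sensing_procedure R n U) (Shat : estimator R n)
    (budget : forall S : {set 'I_n}, support_class s k S ->
      (\int[P]_om total_precision proc (signal mu S) (Z om) (W ^~ om)
         <= m%:E)%E)
    (risk : forall S : {set 'I_n}, support_class s k S ->
      ('E_P[fun om => #|symdiff
          (estimate Shat (collected_data proc (signal mu S) (Z om) (W ^~ om)))
          S|%:R] <= eps%:E)%E) :
  Num.sqrt (2 * (n - s * k)%:R / (s%:R * m) *
    (ln k%:R + ln ((n - s * k)%:R / (n + s)%:R) + ln (s%:R / (8 * eps)))) <= mu.
Proof.
(* With k = q + 1, the base sets [T] have q blocks and the enlarged ones q + 1. *)
case: k k_ge1 sk_lt_n budget risk => [//|q] _ sk_lt_n budget risk.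
set N := (n %/ s)%N.
pose D : R := (n - s * q.+1)%:R.
pose K : R := mu ^+ 2 / 2 * (s%:R * m / D).
pose c := K + 1.
have D0 : 0 < D by rewrite ltr0n subn_gt0.
have s0 : 0 < s%:R :> R by rewrite ltr0n.
have K0 : 0 <= K by rewrite mulr_ge0 ?divr_ge0 ?mulr_ge0 ?sqr_ge0 ?ltW.
have c0 : 0 <= c by rewrite addr_ge0.
pose err (T : {set 'I_N}) i := error Z W proc Shat mu (blocks n s T) i.
have err0 T i : 0 <= err T i by exact: error_ge0.
have riskT (T : {set 'I_N}) : #|T| = q \/ #|T| = q.+1 -> \sum_i err T i <= eps.
  move=> cT; rewrite -lee_fin -sum_errorE; apply: risk.
  by apply: blocks_support_class => //; rewrite subn1; case: cT; [right|left].
pose klT (T : {set 'I_N}) b :=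
  kl Z W proc mu (blocks n s (b |: T)%SET) (blocks n s T).
have klT0 T b : (0 <= klT T b)%E by exact: kl_ge0.
have sum_klT (T : {set 'I_N}) : #|T| = q ->
    (\sum_(b in (~: T)%SET) klT T b <= (mu ^+ 2 / 2 * m)%:E)%E.
  move=> cT; apply: (le_trans (sum_kl Z W proc mu s T s_ge1)).
  rewrite [leRHS]EFinM; apply: lee_wpmul2l.
    by rewrite lee_fin divr_ge0// sqr_ge0.
  by apply: budget; apply: blocks_support_class => //; right; rewrite subn1.
(* Each divergence is dominated by the budgeted sum; its finiteness allows real arithmetic from here
   on. *)
have klT_fin (T : {set 'I_N}) b : #|T| = q -> b \notin T -> klT T b \is a fin_num.
  move=> cT bT; rewrite ge0_fin_numE//; apply: le_lt_trans (ltry (mu ^+ 2 / 2 * m)).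
  apply: le_trans (sum_klT T cT); rewrite (bigD1 b) ?finset.in_setC//= leeDl//.
  exact: sume_ge0.
pose klr T b := fine (klT T b).
have sum_klr (T : {set 'I_N}) : #|T| = q ->
    \sum_(b in (~: T)%SET) klr T b <= mu ^+ 2 / 2 * m.
  move=> cT; rewrite -lee_fin -sumEFin; apply: le_trans (sum_klT T cT).
  by apply: lee_sum => b; rewrite finset.in_setC => bT; rewrite fineK// klT_fin.
have bound (T : {set 'I_N}) b i : #|T| = q -> b \notin T -> i \in block n s b ->
    c <= expR c * (err (b |: T)%SET i + err T i) + klr T b.
  move=> cT bT ib; rewrite -lee_fin [leRHS]EFinD /klr fineK ?klT_fin//.
  apply: error_bound => //; first by rewrite blocksU1 finset.in_setU ib.
  exact: notin_blocks ib.
(* Sum over the s coordinates of all blocks outside [T]. The errors under [T] total at most eps;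
   those under the enlarged sets must wait for the sum over [T]. *)
have boundT (T : {set 'I_N}) : #|T| = q ->
    (N - q)%:R * (s%:R * c) <= expR c * (\sum_(b in (~: T)%SET)
      \sum_(i in block n s b) err (b |: T)%SET i + eps) + s%:R * (mu ^+ 2 / 2 * m).
  move=> cT.
  have -> : (N - q)%:R * (s%:R * c) =
      \sum_(b in (~: T)%SET) \sum_(i in block n s b) c.
    under eq_bigr do rewrite sumr_const card_block// -mulr_natl.
    rewrite sumr_const mulr_natl; congr (_ *+ _).
    by rewrite finset.cardsCs finset.setCK card_ord cT.
  apply: (@le_trans _ _ (\sum_(b in (~: T)%SET) \sum_(i in block n s b)
      (expR c * (err (b |: T)%SET i + err T i) + klr T b))).
    apply: ler_sum => b; rewrite finset.in_setC => bT; apply: ler_sum => i ib.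
    exact: bound.
  under eq_bigr do rewrite big_split -mulr_sumr big_split/= sumr_const
    card_block// -mulr_natl.
  rewrite big_split -mulr_sumr big_split/= -mulr_sumr; apply: lerD.
    apply: ler_wpM2l; first exact: expR_ge0.
    apply: lerD => //; apply: le_trans (riskT T (or_introl cT)).
    exact: sum_blocks.
  by apply: ler_wpM2l; [exact: ltW|exact: sum_klr].
pose C j : R := 'C(N, j)%:R.
have sumC j (r : R) : \sum_(T : {set 'I_N} | #|T| == j) r = C j * r.
  rewrite sumr_const -mulr_natl; congr (_%:R * _).
  by rewrite -[N in RHS]card_ord -card_draws cardsE.
have total : C q * ((N - q)%:R * (s%:R * c)) <=
    expR c * (C q.+1 * eps + C q * eps) + C q * (s%:R * (mu ^+ 2 / 2 * m)).
  rewrite -!sumC.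
  apply: (le_trans (ler_sum _ (fun T cT => boundT T (eqP cT)))).
  rewrite big_split -mulr_sumr big_split/= lerD2r ler_wpM2l ?expR_ge0// lerD2r.
  (* Regrouped by the enlarged set, the remaining errors are at most eps for each set of q + 1
     blocks. *)
  rewrite -(sum_add_block n s _ q (fun T b => \sum_(i in block n s b) err T i)).
  apply: ler_sum => T /eqP cT; apply: le_trans (riskT T (or_intror cT)).
  exact: sum_blocks.
have kN : (q < N)%N by rewrite leq_divRL// mulnC ltnW.
(* Yields n - s k <= s (N - q): fewer than s coordinates lie outside all blocks. *)
have nN : (n < N.+1 * s)%N by exact: ltn_ceil.
apply: (@ln_bound_sqrt R D _ _ _ m mu eps K) => //.
- by rewrite ltr0n addn_gt0 n_ge1.
apply: (@averaged_bound R (C q) (C q.+1) (N - q)%:R D _ _ c K (expR (K + 1)) eps _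
  (mu ^+ 2 / 2 * m)) => //.
- by rewrite ltr0n bin_gt0 ltnW.
- by rewrite ltr0n subn_gt0.
- by rewrite mulr_ge0// ?divr_ge0 ?sqr_ge0 ?ltW.
- exact: ltW.
- by rewrite /C -natrM mul_bin_left natrM.
- rewrite /D -natrM ler_nat mulnBr leq_subLR mulnS -addnA subnKC.
    by rewrite mulnC -mulSn ltnW.
  by rewrite leq_mul2l (ltnW kN) orbT.
- by rewrite /D -natrM -natrD subnK ?(ltnW sk_lt_n)// ler_nat leq_addr.
- by rewrite /K -[RHS]mulrA; congr (_ * _); rewrite -mulrA mulrCA.
Qed.
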